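(* Let $E\subseteq\mathbb R^{+}$ be strongly porous on the right at $0$ and let $0\in ac\,E$. The preordered set $(\tilde I_E^{d},\preceq)$ contains a universal element if and only if there is a constant $c>1$ such that for every $K>1$ there is $t>0$ such that for every $(a,b)\in Com$ the inequalities $a<t$ and $\frac{b}{a}>c$ imply the inequality $\frac{b}{a}>K$.
   Context: $\mathbb R^{+}=[0,\infty)$ with the standard topology. For $E\subseteq\mathbb R^{+}$, $Ext\,E$ is the exterior of $E$ and $ac\,E$ the set of accumulation points of $E$ (both relative to $\mathbb R^{+}$). $Com$ denotes the set of all connected components of $Ext\,E$. The right porosity of $E$ at $0$ is $p^{+}(E,0)=\limsup_{h\to0^{+}}\lambda(E,0,h)/h$, where $\lambda(E,0,h)$ is the length of the largest open subinterval of $(0,h)$ containing no point of $E$; $E$ is strongly porous on the right at $0$ if $p^{+}(E,0)=1$. A real sequence $\{\tau_n\}$ is almost decreasing if $\tau_{n+1}\le\tau_n$ for all sufficiently large $n$. $\tilde I_E$ is the set of sequences $\{(a_n,b_n)\}_{n\in\mathbb N}$ of open intervals $(a_n,b_n)\subseteq\mathbb R^{+}$ such that every $a_n>0$; every $(a_n,b_n)$ is a connected component of $Ext\,E$ (that is, $(a_n,b_n)\cap E=\varnothing$, and every open interval $(a,b)\supseteq(a_n,b_n)$ with $(a,b)\ne(a_n,b_n)$ meets $E$); $\lim_n a_n=0$; and $\lim_n (b_n-a_n)/b_n=1$. $\tilde I_E^{d}$ is the set of those $\{(a_n,b_n)\}\in\tilde I_E$ for which $\{a_n\}$ is almost decreasing.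 For $\tilde A=\{(a_n,b_n)\}$ and $\tilde L=\{(l_n,m_n)\}$ in $\tilde I_E^{d}$, write $\tilde A\preceq\tilde L$ if there are $N_1\in\mathbb N$ and a function $f:\{N_1,N_1+1,\dots\}\to\mathbb N$ with $a_n=l_{f(n)}$ for all $n\ge N_1$. An element $\tilde L\in\tilde I_E^{d}$ is universal if $\tilde A\preceq\tilde L$ for every $\tilde A\in\tilde I_E^{d}$. *)

(* Defs.v *)
From mathcomp Require Import all_boot all_order all_algebra.
From mathcomp Require Import all_classical all_reals all_analysis.

Set Implicit Arguments.
Unset Strict Implicit.
Unset Printing Implicit Defensive.

Import Order.TTheory GRing.Theory Num.Theory.
Import numFieldNormedType.Exports.

Local Open Scope classical_set_scope.
Local Open Scope ring_scope.

Definition Rplus (R : realType) : set R := [set x | 0 <= x].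

(* Exterior relative to Rplus: since Rplus is closed in R, the relative closure
   of a subset of Rplus is its closure in R. *)
Definition Ext (R : realType) (E : set R) : set R := @Rplus R `\` closure E.

Definition Com (R : realType) (E : set R) : set (set R) :=
  [set C | exists2 x, Ext E x & C = connected_component (Ext E) x].

(* The right end point may be infinite: when E is bounded, the exterior of E has
   an unbounded component. *)
Definition oitv (R : realType) (a : R) (b : \bar R) : set R :=
  [set x | (a%:E < x%:E)%E /\ (x%:E < b)%E].

(* Degenerate pairs c = d are allowed, so that gap_length is 0 when E meets
   every nonempty open subinterval of (0, h). *)
Definition gap_length (R : realType) (E : set R) (h : R) : R :=
  sup [set l | exists c d : R, [/\ 0 <= c, c <= d, d <= h,
                               oitv c d%:E `&` E = set0 & l = d - c]].

Definition right_porosity (R : realType) (E : set R) : \bar R :=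
  limf_esup (fun h : R => (gap_length E h / h)%:E) (0 : R)^'+.

Definition strongly_porous_right (R : realType) (E : set R) : Prop :=
  right_porosity E = 1%:E.

Definition almost_decreasing (R : realType) (tau : nat -> R) : Prop :=
  \forall n \near \oo, tau n.+1 <= tau n.

(* A sequence A represents the sequence of intervals ((A n).1, (A n).2). *)
Definition Itilde (R : realType) (E : set R) : set (nat -> R * R) :=
  [set A | [/\ forall n, 0 < (A n).1,
               forall n, Com E (oitv (A n).1 (A n).2%:E),
               (A n).1 @[n --> \oo] --> 0
             & ((A n).2 - (A n).1) / (A n).2 @[n --> \oo] --> (1 : R)]].

Definition Itilde_d (R : realType) (E : set R) : set (nat -> R * R) :=
  [set A | Itilde E A /\ almost_decreasing (fun n => (A n).1)].

(* Only the values of f on the indices n >= N1 matter. *)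
Definition preceq (R : realType) (A L : nat -> R * R) : Prop :=
  exists (N1 : nat) (f : nat -> nat),
    forall n : nat, (N1 <= n)%N -> (A n).1 = (L (f n)).1.

Definition universal (R : realType) (E : set R) (L : nat -> R * R) : Prop :=
  Itilde_d E L /\ forall A, Itilde_d E A -> preceq A L.

(* Main.v *)
Require Import Defs.
From mathcomp Require Import all_boot all_order all_algebra.
From mathcomp Require Import all_classical all_reals all_analysis.
From mathcomp Require Import lra.
Import Order.TTheory GRing.Theory Num.Theory.
Import numFieldNormedType.Exports.
Local Open Scope classical_set_scope.
Local Open Scope ring_scope.

(** A sequence of components [(a n, b n)] of the exterior, with [a n] positive,
    belongs to [Itilde_d E] when the left end points [a n] are eventually
    nonincreasing and tend to [0] while the ratios [b n / a n] tend to infinity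
    ([cvg_ratioP]).  Components of the exterior are pairwise disjoint,
    so each is determined by its left end point ([Com_right_unique]), and
    comparing sequences by left end points amounts to comparing intervals.

    If no threshold [c] separates bounded ratios from large ones, then for each
    [n] there is a bound [K] such that arbitrarily close to [0] there are
    components with ratio in [(n + 2, K]].  A given [L] has ratios tending to
    infinity, so only finitely many of its intervals have ratio at most [K],
    and near [0] such a component is not a term of [L].  Selecting one for each
    [n], closer and closer to [0], gives a member of [Itilde_d E] none of
    whose terms occurs in [L]; hence [L] is not universal
    ([universal_ratio_gap]).

    Conversely, suppose that a threshold [c] exists, and let [S] be the set of
    left end points of the bounded components of ratio greater than [c].  As
    distinct components are disjoint, two points [a < a'] of [S] satisfy
    [c * a < a'], so [S] can be listed downwards from [1] without omission
    ([separated_enum]); porosity makes it accumulate at [0] ([porous_Com]).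
    The assumption on [c] makes the ratios along this list tend to infinity, so
    the list is a member of [Itilde_d E].  It is universal because the
    intervals of any other member eventually have ratio greater than [c]
    ([ratio_gap_universal]). *)

Set Implicit Arguments.
Unset Strict Implicit.
Unset Printing Implicit Defensive.

(** * Connected components of the exterior *)

Lemma Com_sub_Ext (R : realType) (E C : set R) : Com E C -> C `<=` Ext E.
Proof. by case=> x Ex ->; exact: connected_component_sub. Qed.

Lemma Com_nonempty (R : realType) (E C : set R) : Com E C -> C !=set0.
Proof. by case=> x Ex ->; exists x; exact: connected_component_refl. Qed.

Lemma Com_maximal (R : realType) (E C D : set R) :
  Com E C -> connected D -> D `<=` Ext E -> D `&` C !=set0 -> D `<=` C.
Proof.
move=> [x Ex ->] cD DE [y [Dy xy]].
rewrite (same_connected_component xy).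
exact: connected_component_max.
Qed.

Lemma Com_connected (R : realType) (E C : set R) : Com E C -> connected C.
Proof. by case=> x _ ->; exact: component_connected. Qed.

Lemma Com_meet_eq (R : realType) (E C D : set R) :
  Com E C -> Com E D -> C `&` D !=set0 -> C = D.
Proof.
move=> hC hD CD; apply/seteqP; split.
  exact: (Com_maximal hD (Com_connected hC) (Com_sub_Ext hC) CD).
apply: (Com_maximal hC (Com_connected hD) (Com_sub_Ext hD)).
by rewrite setIC.
Qed.

Lemma Com_lt (R : realType) (E : set R) (a b : R) :
  Com E (oitv a b%:E) -> a < b.
Proof.
by move=> /Com_nonempty[y [ay yb]]; rewrite -lte_fin; exact: lt_trans yb.
Qed.

(** This is what makes [preceq], which only looks at left end points, a
    comparison of intervals. *)
Lemma Com_right_unique (R : realType) (E : set R) (a : R) (b b' : \bar R) :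
  Com E (oitv a b) -> Com E (oitv a b') -> b = b'.
Proof.
wlog bb' : b b' / (b < b')%E => [wl hb hb'|hb hb'].
  by have [bb'|bb'|//] := ltgtP b b'; [exact: wl|symmetry; exact: wl].
have [x [ax xb]] := Com_nonempty hb.
have eqC : oitv a b = oitv a b'.
  by apply: Com_meet_eq hb hb' _; exists x; split; split=> //;
    exact: lt_trans bb'.
case: b => [r| |] in bb' hb xb eqC *; last by [].
- have : oitv a b' r by split=> //; exact: lt_trans xb.
  by rewrite -eqC => -[_]; rewrite ltxx.
- by have := leey b'; rewrite leNgt bb'.
Qed.

(** Otherwise the two components would meet, hence be equal, although [a']
    belongs to the first one only. *)
Lemma Com_ordered (R : realType) (E : set R) (a a' : R) (b b' : \bar R) :
  Com E (oitv a b) -> Com E (oitv a' b') -> a < a' -> (b <= a'%:E)%E.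
Proof.
move=> hC hC' aa'; rewrite leNgt; apply/negP => a'b.
have [y [a'y yb']] := Com_nonempty hC'.
suff eqC : oitv a b = oitv a' b'.
  have : oitv a b a' by split.
  by rewrite eqC => -[]; rewrite ltxx.
apply: (Com_meet_eq hC hC').
have [yb|] := ltP y%:E b.
  exists y; split; split=> //; rewrite lte_fin in a'y *; exact: lt_trans a'y.
(* [y] lies to the right of the first interval: move back towards [a']. *)
case: b => [b| |] in a'b {hC} * => //.
rewrite !lte_fin lee_fin in a'b a'y * => b_y.
pose z := (a' + b) / 2.
have [a'z zb zy] : [/\ a' < z, z < b & z <= y] by rewrite /z; split; lra.
exists z; split; split; rewrite ?lte_fin//; first exact: lt_trans a'z.
by apply: le_lt_trans yb'; rewrite lee_fin.
Qed.

(** * Components near an accumulation point at the origin *)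

Lemma limit_point0_lt (R : realType) (E : set R) (t : R) :
  E `<=` @Rplus R -> limit_point E (0 : R) -> 0 < t ->
  exists e, [/\ E e, 0 < e & e < t].
Proof.
move=> hE hac t0.
have [e [e0 Ee /= et]] := hac _ (nbhsx_ballx (0 : R) t t0).
exists e; split=> //; first by rewrite lt_neqAle eq_sym e0; exact: hE.
by move: et; rewrite /ball/= sub0r normrN ger0_norm//; exact: hE.
Qed.

(** A component starting at [0] would keep [E] away from [0] on the right. *)
Lemma Com_left_gt0 (R : realType) (E : set R) (a : R) (b : \bar R) :
  E `<=` @Rplus R -> limit_point E (0 : R) -> Com E (oitv a b) -> 0 < a.
Proof.
move=> hE hac hC; rewrite ltNge; apply/negP => a0.
have [y [ay yb]] := Com_nonempty hC.
have yC : oitv a b y by split.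
have [y0 _] := Com_sub_Ext hC yC.
have y_gt0 : 0 < y.
  rewrite lt_neqAle y0 andbT; apply/eqP => y00.
  have [_] := Com_sub_Ext hC yC; rewrite -y00; apply.
  exact: subset_limit_point.
have [e [Ee e0 ey]] := limit_point0_lt hE hac y_gt0.
have : oitv a b e.
  split; first by rewrite lte_fin (le_lt_trans a0).
  by apply: lt_trans yb; rewrite lte_fin.
by move=> /(Com_sub_Ext hC)[_]; apply; exact: subset_closure.
Qed.

(** The component containing a gap [(c, d)] is an interval, bounded above by
    any point [e] of [E] beyond the gap.  It is open because [0] lies in the
    closure of [E], which makes the exterior an open subset of the line and not
    just of the half-line; it is therefore the open interval between its
    infimum and its supremum. *)
Lemma gap_in_Com (R : realType) (E : set R) (c d e : R) :
  limit_point E (0 : R) -> 0 <= c -> c < d ->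
  oitv c d%:E `&` E = set0 -> E e -> d <= e ->
  exists a b : R, [/\ Com E (oitv a b%:E), a <= c & d <= b].
Proof.
move=> hac c0 cd cdE Ee de.
have E0 : closure E 0 by exact: subset_limit_point.
have cdEx : oitv c d%:E `<=` Ext E.
  move=> x cdx; split; first by apply: ltW; apply: le_lt_trans c0 _; case: cdx.
  move=> /(_ (oitv c d%:E)) []; last first.
    by move=> z [Ez cdz]; rewrite -[False]/(set0 z) -cdE.
  case: cdx; rewrite !lte_fin => cx xd.
  have xcd : x \in `]c, d[ by rewrite in_itv/= cx.
  apply: filterS (near_in_itvoo xcd) => z; rewrite in_itv/= => /andP[cz zd].
  by split; rewrite lte_fin.
pose x := (c + d) / 2.
have cdx : oitv c d%:E x by split; rewrite lte_fin /x; lra.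
pose C := connected_component (Ext E) x.
have ComC : Com E C by exists x => //; exact: cdEx.
have iC : is_interval C by apply/connected_intervalP; exact: Com_connected ComC.
have Cx : C x by apply: connected_component_refl; exact: cdEx.
have iD : connected (oitv c d%:E).
  apply/connected_intervalP => u v [cu ud] [cv vd] z /andP[uz zv]; split.
    by apply: (lt_le_trans cu); rewrite lee_fin.
  by apply: le_lt_trans vd; rewrite lee_fin.
have DC : oitv c d%:E `<=` C.
  exact: (Com_maximal ComC iD cdEx (ex_intro _ x (conj cdx Cx))).
(* A ball around [y] contained in the exterior is connected, so it stays in
   the component of [y]. *)
have oC : open C.
  rewrite openE => y Cy.
  have [y0 yE] := Com_sub_Ext ComC Cy.
  have y_gt0 : 0 < y.
    by rewrite lt_neqAle y0 andbT; apply/eqP => y00; apply: yE; rewrite -y00.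
  have : nbhs y (~` closure E `&` [set z | 0 < z]).
    apply: open_nbhs_nbhs; split=> //; apply: openI; last exact: open_gt.
    by rewrite openC; exact: closed_closure.
  move=> /nbhs_ballP[r /= r0 rE]; apply/nbhs_ballP; exists r => //.
  apply: (Com_maximal ComC).
  - apply/connected_intervalP; rewrite ball_itv; exact: interval_is_interval.
  - by move=> z /rE[? /ltW].
  - by exists y; split=> //; exact: ballxx.
have lC : lbound C 0 by move=> z /(Com_sub_Ext ComC)[].
have uC : ubound C e.
  move=> z Cz; rewrite leNgt; apply/negP => ez.
  have : C e.
    apply: iC Cx Cz _ _; rewrite (ltW ez) andbT.
    by case: cdx => _; rewrite lte_fin => xd; rewrite (le_trans (ltW xd)).
  by move=> /(Com_sub_Ext ComC)[_]; apply; exact: subset_closure.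
have hl : has_lbound C by exists 0.
have hu : has_ubound C by exists e.
have CE : C = oitv (inf C) (sup C)%:E.
  rewrite -[LHS](interior_id _).1// interval_bounded_interior//.
  by apply/seteqP; split=> z; rewrite /oitv /= !lte_fin => /andP.
exists (inf C), (sup C); split; first by rewrite -CE.
- rewrite leNgt; apply/negP => ci.
  pose z := (c + Num.min d (inf C)) / 2.
  have [zi zd cz] : [/\ z < inf C, z < d & c < z].
    by rewrite /z; case: (leP d (inf C)) => h; split; lra.
  have /DC /(ge_inf hl) : oitv c d%:E z by split.
  lra.
- rewrite leNgt; apply/negP => sd.
  pose z := (d + Num.max c (sup C)) / 2.
  have [zi zd cz] : [/\ sup C < z, z < d & c < z].
    by rewrite /z; case: (leP c (sup C)) => h; split; lra.
  have /DC /(ub_le_sup hu) : oitv c d%:E z by split.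
  lra.
Unshelve. all: by end_near. Qed.

(** An upper limit equal to [1] yields arbitrarily small [h] with a gap
    [(c, d)] in [(0, h)] longer than [(1 - eps) * h], hence longer than
    [(1 - eps) * d]; such a gap has [c < eps * d]. *)
Lemma porous_gap (R : realType) (E : set R) (eps t : R) :
  strongly_porous_right E -> 0 < eps -> 0 < t ->
  exists c d : R, [/\ 0 <= c, c < eps * d, d < t & oitv c d%:E `&` E = set0].
Proof.
move=> hpor eps0 t0.
(* For [eps < 1] the factor [1 - eps] is positive; larger values only weaken
   the conclusion. *)
wlog eps1 : eps eps0 / eps < 1 => [wl|].
  have [||c [d [c0 cd dt cdE]]] := wl (Num.min eps (1/2)).
  - by rewrite lt_min eps0/=; lra.
  - by rewrite gt_min; apply/orP; right; lra.
  have d0 : 0 <= d.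
    rewrite leNgt; apply/negP => d0; move: cd; rewrite ltNge => /negP; apply.
    apply: le_trans c0; rewrite pmulr_rle0 ?(ltW d0)// lt_min eps0; lra.
  exists c, d; split=> //; apply: lt_le_trans cd _.
  by rewrite ler_wpM2r// ge_min lexx.
have nt : nbhs (0 : R)^'+ [set h : R | 0 < h /\ h < t].
  near=> h; split; near: h; [exact: nbhs_right_gt|exact: nbhs_right_lt].
have : ((1 - eps)%:E < right_porosity E)%E by rewrite hpor lte_fin; lra.
move=> /lt_le_trans /(_ (ereal_inf_lbound (ex_intro2 _ _ _ nt erefl))).
move=> /ereal_sup_gt[_ [h [h0 ht] <-]].
rewrite lte_fin ltr_pdivlMr// => /sup_gt[|_ [c [d [c0 cd dh cdE ->]]] hcd].
  (* The degenerate gap shows that the supremum is over a nonempty set. *)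
  exists 0, 0, 0; split; rewrite ?subrr//; first exact: ltW.
  by rewrite -subset0 => z [[/lt_trans /[apply]]]; rewrite ltxx.
exists c, d; split=> //; last exact: le_lt_trans ht.
have : (1 - eps) * d <= (1 - eps) * h by rewrite ler_wpM2l//; lra.
lra.
Unshelve. all: by end_near. Qed.

(** Choosing the gaps to the left of some point of [E] forces the components
    around them to be bounded. *)
Lemma porous_Com (R : realType) (E : set R) (K t : R) :
  E `<=` @Rplus R -> limit_point E (0 : R) -> strongly_porous_right E ->
  1 < K -> 0 < t ->
  exists a b : R, [/\ Com E (oitv a b%:E), a < t & K * a < b].
Proof.
move=> hE hac hpor K1 t0.
have [e [Ee e0 et]] := limit_point0_lt hE hac t0.
have K0 : 0 < K by lra.
have [|c [d [c0 + de cdE]]] := @porous_gap _ E K^-1 e hpor _ e0.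
  by rewrite invr_gt0.
rewrite ltr_pdivlMl// => Kcd.
have cd : c < d by nra.
have [a [b [hC ac db]]] := gap_in_Com hac c0 cd cdE Ee (ltW de).
exists a, b; split=> //; first lra.
by apply: lt_le_trans db; apply: le_lt_trans Kcd; rewrite ler_pM2l.
Qed.

(** * Ratios of end points *)

(** Clearing the denominator lets finite and infinite right end points be
    treated alike. *)
Lemma lt_ratioE (R : realType) (c a : R) (b : \bar R) : 0 < a ->
  (c%:E < b / a%:E)%E = ((c * a)%:E < b)%E.
Proof. by move=> a0; rewrite inver gt_eqF// lte_pdivlMr// EFinM. Qed.

(** Since [1 - (b n - a n) / b n = a n / b n], the relative lengths tend to [1]
    exactly when the ratios [b n / a n] tend to infinity. *)
Lemma cvg_ratioP (R : realType) (a b : nat -> R) :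
  (forall n, 0 < a n) -> (forall n, a n < b n) ->
  (b n - a n) / b n @[n --> \oo] --> (1 : R) <->
  forall K : R, 0 < K -> \forall n \near \oo, K * a n < b n.
Proof.
move=> a0 ab.
have b0 n : 0 < b n by exact: lt_trans (ab n).
have E n : 1 - (b n - a n) / b n = a n / b n.
  by rewrite mulrBl divff ?gt_eqF// opprB addrCA subrr addr0.
have dist n K : 0 < K ->
    (`|1 - (b n - a n) / b n| < K^-1) = (K * a n < b n).
  move=> K0; rewrite E ger0_norm ?divr_ge0 ?ltW//.
  by rewrite ltr_pdivrMr// ltr_pdivlMl.
split=> [/cvgrPdist_lt h K K0|h].
  have Ki : 0 < K^-1 by rewrite invr_gt0.
  by apply: filterS (h _ Ki) => n; rewrite dist.
apply/cvgrPdist_lt => e e0.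
have ei : 0 < e^-1 by rewrite invr_gt0.
by apply: filterS (h _ ei) => n; rewrite -dist// invrK.
Qed.

(** * Sequences decreasing to zero *)

(** The [n]-th choice is made below both its predecessor and [1 / (n + 1)]. *)
Lemma decreasing_choice (R : realType) (P : nat -> R * R -> Prop) :
  (forall n t, 0 < t -> exists p, [/\ P n p, 0 < p.1 & p.1 < t]) ->
  exists A : nat -> R * R, [/\ forall n, P n (A n),
    forall n, (A n.+1).1 < (A n).1 & (A n).1 @[n --> \oo] --> (0 : R)].
Proof.
move=> hP.
have /choice[g hg] : forall q : nat * R, exists p,
    0 < q.2 -> [/\ P q.1 p, 0 < p.1 & p.1 < q.2].
  move=> [n t]; have [t0|t0] := ltP 0 t; last by exists (0, 0).
  by have [p ?] := hP n t t0; exists p.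
pose fix A n := g (n, if n is m.+1 then Num.min (A m).1 (harmonic n) else 1).
have A0 n : 0 < (A n).1.
  elim: n => [|n IH] /=; first by case: (hg (0%N, 1)) => /=.
  case: (hg (n.+1, Num.min (A n).1 (harmonic n.+1))) => //=.
  by rewrite lt_min IH/= invr_gt0.
have AP n : P n (A n).
  case: n => [|n] /=; first by case: (hg (0%N, 1)) => /=.
  case: (hg (n.+1, Num.min (A n).1 (harmonic n.+1))) => //=.
  by rewrite lt_min A0/= invr_gt0.
have AS n : (A n.+1).1 < Num.min (A n).1 (harmonic n.+1).
  case: (hg (n.+1, Num.min (A n).1 (harmonic n.+1))) => //=.
  by rewrite lt_min A0/= invr_gt0.
exists A; split=> // [n|].
  by apply: lt_le_trans (AS n) _; rewrite ge_min lexx.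
apply: squeeze_cvgr (cvg_cst 0) (@cvg_harmonic R); apply: nearW => -[|n].
  rewrite (ltW (A0 0%N))/= /harmonic/= invr1.
  by case: (hg (0%N, 1)) => //= _ _ /ltW.
rewrite (ltW (A0 _))/=; apply: le_trans (ltW (AS n)) _.
by rewrite ge_min lexx orbT.
Qed.

(** The part of [S] below a positive [x] has a greatest element: a point of it
    above [sup / c] cannot be followed by another, which would have to exceed
    the supremum.  Taking greatest elements repeatedly lists [S] downwards, and
    the list shrinks geometrically, so no element of [S] below [1] is
    skipped. *)
Lemma separated_enum (R : realType) (S : set R) (c : R) :
  1 < c -> (forall a, S a -> 0 < a) ->
  (forall a a', S a -> S a' -> a < a' -> c * a < a') ->
  (forall t, 0 < t -> exists2 a, S a & a < t) ->
  exists s : nat -> R, [/\ forall n, S (s n), forall n, s n.+1 < s n,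
    s n @[n --> \oo] --> (0 : R)
    & forall a, S a -> a < 1 -> exists n, a = s n].
Proof.
move=> c1 S0 sepS accS.
have c0 : 0 < c by lra.
have /choice[f hf] : forall x, exists m, 0 < x ->
    [/\ S m, m < x & forall a, S a -> a < x -> a <= m].
  move=> x; have [x0|_] := ltP 0 x; last by exists 0.
  pose B := S `&` [set a | a < x].
  have [a1 Sa1 a1x] := accS _ x0.
  have ubB : has_ubound B by exists x => a [_ /ltW].
  have sB : 0 < sup B.
    by apply: lt_le_trans (S0 _ Sa1) _; apply: ub_le_sup.
  have B0 : B !=set0 by exists a1.
  have [|m [Sm mx] sm] := @sup_gt R B (c^-1 * sup B) B0.
    by rewrite ltr_pdivrMl//; nra.
  exists m => _; split=> // a Sa ax; rewrite leNgt; apply/negP => ma.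
  have := sepS _ _ Sm Sa ma; rewrite ltr_pdivrMl// in sm => cma.
  have : a <= sup B by apply: ub_le_sup.
  lra.
pose s n := iter n.+1 f 1.
have s0 n : 0 < s n by elim: n => [|n /hf[/S0]//]; have [//|/S0] := hf 1.
have Ss n : S (s n).
  by case: n => [|n]; [have [] := hf 1|have [] := hf _ (s0 n)].
have sS n : s n.+1 < s n by have [] := hf _ (s0 n).
have cs n : s n <= c^-1 ^+ n.
  elim: n => [|n IH].
    by rewrite expr0; have [//|_ /ltW] := hf 1.
  rewrite exprS ler_pdivlMl//; apply: le_trans IH; apply: ltW; exact: sepS.
have s_cvg : s n @[n --> \oo] --> (0 : R).
  apply: (@squeeze_cvgr _ _ _ _ (fun=> 0) (fun n => c^-1 ^+ n)).
  - by apply: nearW => n; rewrite ltW//=.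
  - exact: cvg_cst.
  - apply: cvg_expr; rewrite ger0_norm ?invr_ge0 ?ltW//.
    by rewrite invf_lt1.
exists s; split=> // a Sa a1.
have a0 := S0 _ Sa.
have ex : exists n, s n <= a.
  have /cvgr0Pnorm_lt /(_ _ a0) [N _ /(_ N (leqnn N)) h] := s_cvg.
  by exists N; rewrite ltW// (le_lt_trans (ler_norm _)).
(* The first term not exceeding [a] is the greatest element of [S] below a
   bound that still exceeds [a], so it is [a] itself. *)
case: (ex_minnP ex) => -[|n] sna minn.
  exists 0%N; apply/eqP; rewrite eq_le sna andbT.
  by have [//|_ _] := hf 1; exact.
exists n.+1; apply/eqP; rewrite eq_le sna andbT.
have [_ _] := hf _ (s0 n); apply=> //.
by rewrite ltNge; apply/negP => /minn; rewrite ltnn.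
Qed.

(** The finitely many exceptional indices are excluded by going below the
    smallest of the corresponding values. *)
Lemma eventually_of_small (R : realType) (a : nat -> R) (P : nat -> Prop) :
  (forall n, 0 < a n) -> (\forall n \near \oo, P n) ->
  exists2 d, 0 < d & forall m, a m < d -> P m.
Proof.
move=> a0 [N _ hN].
have [d d0 hd] : exists2 d, 0 < d & forall m, (m < N)%N -> d <= a m.
  elim: N {hN} => [|N [d d0 hd]]; first by exists 1.
  exists (Num.min d (a N)) => [|m]; first by rewrite lt_min d0 a0.
  rewrite ltnS leq_eqVlt => /predU1P[->|/hd dm].
    by rewrite ge_min lexx orbT.
  by rewrite ge_min dm.
exists d => // m; have [Nm _|/hd dm] := leqP N m; first exact: hN.
by rewrite ltNge dm.
Qed.

(** * The two implications *)

Lemma universal_ratio_gap (R : realType) (E : set R) :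
  E `<=` @Rplus R -> limit_point E (0 : R) ->
  (exists L : nat -> R * R, universal E L) ->
  exists c : R, 1 < c /\
     forall K : R, 1 < K ->
       exists t : R, 0 < t /\
         forall (a : R) (b : \bar R), Com E (oitv a b) ->
           a < t -> (c%:E < b / a%:E)%E -> (K%:E < b / a%:E)%E.
Proof.
move=> hE hac [L [[[L0 LC _ Lr] _] Luniv]]; apply: contrapT => noc.
have Llt n : (L n).1 < (L n).2 by exact: Com_lt (LC n).
have Lratio := (cvg_ratioP L0 Llt).1 Lr.
pose P n (p : R * R) := [/\ Com E (oitv p.1 p.2%:E), n.+2%:R * p.1 < p.2
  & forall m, p.1 != (L m).1].
have step n t : 0 < t -> exists p, [/\ P n p, 0 < p.1 & p.1 < t].
  move=> t0; apply: contrapT => nop; apply: noc.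
  (* The indices start at [2] so that the threshold exceeds [1]. *)
  exists n.+2%:R; split; first by rewrite ltr1n.
  move=> K K1; have K0 : 0 < K by lra.
  have [d d0 hd] := eventually_of_small L0 (Lratio _ K0).
  exists (Num.min t d); split; first by rewrite lt_min t0.
  move=> a b hC; rewrite lt_min => /andP[at_ ad].
  have a0 := Com_left_gt0 hE hac hC; rewrite !lt_ratioE// => cb.
  rewrite ltNge; apply/negP => bK.
  case: b => [b| |] in hC cb bK * => //.
  apply: nop; exists (a, b); split=> //; split=> // m; apply/eqP => /= aL.
  have := LC m; rewrite -aL => /(Com_right_unique hC)[bL].
  have := hd m; rewrite -aL -bL => /(_ ad).
  by rewrite ltNge -lee_fin bK.
have [A [hA Adec Acvg]] := decreasing_choice step.
have AC n : Com E (oitv (A n).1 (A n).2%:E) by have [] := hA n.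
have A0 n : 0 < (A n).1 by exact: Com_left_gt0 (AC n).
have Abig n : n.+2%:R * (A n).1 < (A n).2 by have [] := hA n.
have Alt n : (A n).1 < (A n).2 by exact: Com_lt (AC n).
have AE : Itilde_d E A.
  split; last by apply: nearW => n; exact: ltW.
  split=> //; apply/cvg_ratioP => // K K0.
  near=> n; apply: lt_trans (Abig n); rewrite ltr_pM2r//.
  apply: (@le_lt_trans _ _ n%:R); last by rewrite ltr_nat.
  by near: n; exact: nbhs_infty_ger.
(* No term of [A] is a term of [L]. *)
have [N [f hf]] := Luniv A AE.
by have [_ _ /(_ (f N))/eqP] := hA N; apply; exact: hf.
Unshelve. all: by end_near. Qed.

(** Bounded components suffice, since members of [Itilde_d E] have finite right
    end points. *)
Lemma ratio_gap_universal (R : realType) (E : set R) :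
  E `<=` @Rplus R -> strongly_porous_right E -> limit_point E (0 : R) ->
  (exists c : R, 1 < c /\
     forall K : R, 1 < K ->
       exists t : R, 0 < t /\
         forall (a : R) (b : \bar R), Com E (oitv a b) ->
           a < t -> (c%:E < b / a%:E)%E -> (K%:E < b / a%:E)%E) ->
  exists L : nat -> R * R, universal E L.
Proof.
move=> hE hpor hac [c [c1 hc]].
pose S : set R := [set a | exists b : R, Com E (oitv a b%:E) /\ c * a < b].
have S0 a : S a -> 0 < a by case=> b [hC _]; exact: Com_left_gt0 hC.
have [||s [Ss sS scvg senum]] := separated_enum c1 S0.
- move=> a a' [b [hC cab]] [b' [hC' _]] aa'; apply: lt_le_trans cab _.
  by have := Com_ordered hC hC' aa'; rewrite lee_fin.
- move=> t t0; have [a [b [hC at_ cab]]] := porous_Com hE hac hpor c1 t0.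
  by exists a => //; exists b.
have s0 n := S0 _ (Ss n).
have /choice[b hb] := Ss.
exists (fun n => (s n, b n)); split.
  split; last by apply: nearW => n; rewrite /= ltW.
  split=> //= [n|]; first by have [] := hb n.
  apply/cvg_ratioP => // [n|K K0]; first by have [/Com_lt] := hb n.
  (* The assumption is only available above [1], hence the shift of [K]. *)
  have K1 : 1 < K + 1 by lra.
  have [t [t0 ht]] := hc _ K1.
  move/cvgr0Pnorm_lt: scvg => /(_ _ t0); apply: filterS => n.
  rewrite gtr0_norm// => snt; have [hC cb] := hb n.
  have := ht _ _ hC snt; rewrite !lt_ratioE// !lte_fin => /(_ cb).
  by apply: lt_trans; rewrite ltr_pM2r//; lra.
move=> A [[A0 AC Acvg Ar] _].
have Alt n : (A n).1 < (A n).2 by exact: Com_lt (AC n).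
have c0 : 0 < c by lra.
have /cvgr0Pnorm_lt/(_ _ ltr01) Asmall := Acvg.
have [N _ hN] := filterI Asmall ((cvg_ratioP A0 Alt).1 Ar _ c0).
have /choice[f hf] : forall n, exists m, (N <= n)%N -> (A n).1 = s m.
  move=> n; have [/hN[/= A1 cA]|_] := leqP N n; last by exists 0%N.
  rewrite gtr0_norm// in A1.
  have [||m ->] := senum (A n).1; [by exists (A n).2|exact: A1|by exists m].
by exists N, f.
Qed.

Theorem theorem2p26 (R : realType) (E : set R)
    (hE : E `<=` @Rplus R)
    (hpor : strongly_porous_right E)
    (hac : limit_point E (0 : R)) :
  (exists L : nat -> R * R, universal E L) <->
  (exists c : R, 1 < c /\
     forall K : R, 1 < K ->
       exists t : R, 0 < t /\
         forall (a : R) (b : \bar R), Com E (oitv a b) ->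
           a < t -> (c%:E < b / a%:E)%E -> (K%:E < b / a%:E)%E).
Proof.
split; first exact: universal_ratio_gap.
exact: ratio_gap_universal.
Qed.
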